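(* Let $\mathbb I=[0,1]$, let $\mathcal M$ be the ideal of meager subsets of the Hilbert cube $\mathbb I^\omega$, let $\mathcal G_0$ be the family of all minimal dense $G_\delta$-sets in $\mathbb I^\omega$, and let $\sigma\mathcal G_0$ be the $\sigma$-ideal generated by $\mathcal G_0$. If $\mathcal I$ is a topologically invariant ideal with BP-base on $\mathbb I^\omega$ such that $\mathcal I\not\subseteq\mathcal M$, then $\mathcal G_0\subseteq\mathcal I$. If $\mathcal I$ is a topologically invariant $\sigma$-ideal with BP-base on $\mathbb I^\omega$ such that $\mathcal I\not\subseteq\mathcal M$, then $\sigma\mathcal G_0\subseteq\mathcal I$.
   Context: An ideal on a set $X$ is a non-empty family of subsets of $X$ closed under subsets and finite unions; it is a $\sigma$-ideal if it is closed under countable unions. An ideal $\mathcal I$ on a topological space $X$ is topologically invariant if $\mathcal I=\{h(A):A\in\mathcal I\}$ for every homeomorphism $h:X\to X$. A subset $A\subseteq X$ has the Baire property (is a BP-set) if $A\triangle U$ is meager for some open $U\subseteq X$. An ideal $\mathcal I$ has BP-base if each $A\in\mathcal I$ is contained in some BP-set $B\in\mathcal I$. The $\sigma$-ideal $\sigma\mathcal F$ generated by a family $\mathcal F$ consists of all subsets of countable unions of sets from $\mathcal F$. A dense $G_\delta$-subset $A$ of a Polish space $X$ is minimal if for each dense $G_\delta$-set $B\subseteq X$ there is a homeomorphism $h:X\to X$ with $h(A)\subseteq B$. *)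

(* Defs.v *)
From HB Require Import structures.
From mathcomp Require Import all_boot all_order all_algebra.
From mathcomp Require Import all_classical all_reals all_analysis.
From mathcomp Require Export borel_hierarchy.

Set Implicit Arguments.
Unset Strict Implicit.
Unset Printing Implicit Defensive.

Import Order.TTheory GRing.Theory Num.Theory.
Import numFieldNormedType.Exports.

Local Open Scope classical_set_scope.
Local Open Scope ring_scope.

Definition unit_interval (R : realType) : set R := `[0, 1].
Arguments unit_interval R : clear implicits.

Definition hilbert_cube (R : realType) : Type :=
  prod_topology (fun _ : nat => set_type (unit_interval R)).

HB.instance Definition _ (R : realType) := Choice.on (hilbert_cube R).
HB.instance Definition _ (R : realType) := Nbhs.on (hilbert_cube R).
HB.instance Definition _ (R : realType) := Topological.on (hilbert_cube R).
HB.instance Definition _ (R : realType) := Uniform.on (hilbert_cube R).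

(* Properness is not required: the full powerset is an ideal. The empty union
   is covered by non-emptiness and closure under subsets. *)
Definition is_ideal (X : Type) (I : set (set X)) : Prop :=
  [/\ I !=set0,
      (forall A B : set X, A `<=` B -> I B -> I A) &
      (forall A B : set X, I A -> I B -> I (A `|` B))].

Definition is_sigma_ideal (X : Type) (I : set (set X)) : Prop :=
  is_ideal I /\
  (forall F : nat -> set X, (forall n, I (F n)) -> I (\bigcup_n F n)).

(* Countable includes finite and empty, so the generated family contains the
   empty set even when F is empty. *)
Definition sigma_ideal_gen (X : Type) (F : set (set X)) : set (set X) :=
  [set A | exists C : set (set X),
     [/\ countable C, C `<=` F & A `<=` \bigcup_(B in C) B]].

Section Topology.
Context {X : topologicalType}.

Definition homeomorphism (h : X -> X) : Prop :=
  exists g : X -> X,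
    [/\ cancel h g, cancel g h, continuous h & continuous g].

Definition nowhere_dense (A : set X) : Prop := (closure A)° = set0.

Definition meager : set (set X) :=
  [set A | exists2 F : nat -> set X,
     (forall n, nowhere_dense (F n)) & A = \bigcup_n F n].

Definition BP_set (A : set X) : Prop :=
  exists2 U : set X, open U & meager (A `+` U).

Definition topologically_invariant (I : set (set X)) : Prop :=
  forall h : X -> X, homeomorphism h -> I = [set h @` A | A in I].

Definition has_BP_base (I : set (set X)) : Prop :=
  forall A : set X, I A -> exists B : set X, [/\ A `<=` B, BP_set B & I B].

Definition minimal_dense_Gdelta : set (set X) :=
  [set A | [/\ Gdelta A, dense A &
     forall B : set X, Gdelta B -> dense B ->
       exists2 h : X -> X, homeomorphism h & h @` A `<=` B]].

End Topology.

Arguments meager : clear implicits.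
Arguments minimal_dense_Gdelta : clear implicits.

(* Main.v *)
Require Import Defs.
From HB Require Import structures.
From mathcomp Require Import finmap.
From mathcomp Require Import all_boot all_order all_algebra.
From mathcomp Require Import all_classical all_reals all_analysis.
From mathcomp Require Import ring lra.

Set Implicit Arguments.
Unset Strict Implicit.
Unset Printing Implicit Defensive.

Import Order.TTheory GRing.Theory Num.Theory.
Import numFieldNormedType.Exports.

Local Open Scope classical_set_scope.

(* A set of J that is not meager lies in a BP-set B of J, and B contains U \ M
   for a nonempty open U and a meager M. Every homeomorphism orbit of the
   Hilbert cube is dense, so preimages of U under homeomorphisms cover the
   cube; by compactness finitely many suffice, and the union of the
   corresponding preimages of B, a member of J, contains a dense G_delta-set.
   Minimality then carries every set of G_0 into J.

   Density of orbits: a monotone homeomorphism of [0, 1] moves an interior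
   coordinate to any prescribed interior value, and a homeomorphism of the
   square formed by a coordinate equal to 0 or 1 and a fresh coordinate makes
   the former interior. So any finite set of coordinates can be prescribed. *)

(** * Baire category in compact regular spaces *)

(** Regularity yields nonempty open sets [V n], starting from [O], with [closure (V n.+1)] inside
    both [V n] and [F n]. Compactness gives a cluster point of points chosen in the [V n], and it
    lies in every closure. *)
Lemma compact_regular_Baire (X : topologicalType) (F : nat -> set X) :
  compact [set: X] -> regular_space X ->
  (forall n, open (F n) /\ dense (F n)) -> dense (\bigcap_n F n).
Proof.
move=> cX rX oF O O0 oO.
(* The hypotheses on [p.2] stand under the existential so that [choice] gives a total function;
   [set0] is the junk value when they fail. *)
have shrink (p : nat * set X) : exists V : set X, open p.2 -> p.2 !=set0 ->
    [/\ open V, V !=set0 & closure V `<=` p.2 `&` F p.1].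
  have [[op [p0 ]]|np] := pselect (open p.2 /\ p.2 !=set0); last first.
    by exists set0 => op p0; case: np.
  move=> p0x; have [oFp dFp] := oF p.1.
  have [x [px Fx]] := dFp _ (ex_intro _ p0 p0x) op.
  have /rX[W + clW] : nbhs x (p.2 `&` F p.1).
    by apply: open_nbhs_nbhs; split=> //; exact: openI.
  rewrite nbhsE => -[V [oV Vx] VW]; exists V => _ _; split=> //.
    by exists x.
  exact: subset_trans (closure_subset VW) clW.
have [next nextP] := choice shrink.
pose V := fix V n := if n is m.+1 then next (m, V m) else O.
have VP n : open (V n) /\ V n !=set0.
  by elim: n => [//|n [oV V0]] /=; have [] := nextP (n, V n) oV V0.
have VS n : closure (V n.+1) `<=` V n `&` F n.
  by have [oV V0] := VP n; have [] := nextP (n, V n) oV V0.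
have Vle m n : (m <= n)%N -> V n `<=` V m.
  elim: n => [|n IH]; first by rewrite leqn0 => /eqP ->.
  rewrite leq_eqVlt => /predU1P[->//|/IH]; apply: subset_trans.
  by move=> x Vx; have [] := VS n x (subset_closure Vx).
have [x Vx] := choice (fun n => (VP n).2).
have [|p [_ clp]] := cX (x @ \oo) _; first exact: filterT.
have clV n : closure (V n) p.
  move=> B Bp; apply: clp => //; exists n => // m /= nm.
  exact: Vle nm _ (Vx m).
exists p; split; first by have [] := VS 0%N p (clV 1%N).
by move=> n _; have [] := VS n p (clV n.+1).
Qed.

(** * Homeomorphisms, invariant families and meager sets *)

Section Homeomorphisms.
Context {X : topologicalType}.

Lemma homeomorphism_id : homeomorphism (@id X).
Proof. by exists id; split=> // x. Qed.

Lemma homeomorphism_comp (h k : X -> X) :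
  homeomorphism h -> homeomorphism k -> homeomorphism (h \o k).
Proof.
move=> [h' [hK h'K ch ch']] [k' [kK k'K ck ck']]; exists (k' \o h').
split; [exact: can_comp|exact: can_comp| |].
- by move=> x; apply: continuous_comp; [exact: ck|exact: ch].
- by move=> x; apply: continuous_comp; [exact: ch'|exact: ck'].
Qed.

Lemma homeomorphism_inv (h : X -> X) :
  homeomorphism h -> exists2 g, homeomorphism g & cancel h g /\ cancel g h.
Proof. by move=> [g [hg gh ch cg]]; exists g => //; exists h. Qed.

Lemma invariant_image (I : set (set X)) (h : X -> X) (A : set X) :
  topologically_invariant I -> homeomorphism h -> I A -> I (h @` A).
Proof. by move=> invI hh IA; rewrite (invI h hh); exists A. Qed.

Lemma meagerS (A B : set X) : A `<=` B -> meager X B -> meager X A.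
Proof.
move=> AB [F F0 BF]; exists (fun n => A `&` F n) => [n|].
  apply/seteqP; split=> // x; rewrite -(F0 n).
  by apply: interiorS; apply: closureS; exact: subIsetr.
by rewrite -setI_bigcupr -BF; apply/esym/setIidPl.
Qed.

Lemma open_dense_preimage_nowhere_dense (h : X -> X) (A : set X) :
  homeomorphism h -> nowhere_dense A ->
  open (h @^-1` (~` closure A)) /\ dense (h @^-1` (~` closure A)).
Proof.
move=> [g [hK gK ch cg]] A0; split.
  by apply: open_comp => [x _|]; [exact: ch|exact/closed_openC/closed_closure].
move=> O [x Ox] oO.
have oO' : open (g @^-1` O) by apply: open_comp => // y _; exact: cg.
apply: contrapT => nO.
suff : (closure A)° (h x) by rewrite A0.
rewrite /interior nbhsE; exists (g @^-1` O); first by split=> //=; rewrite hK.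
move=> y /= Oy; apply: contrapT => ny; apply: nO; exists (g y).
by split=> //=; rewrite gK.
Qed.

End Homeomorphisms.

(** * Countable intersections of dense open sets *)

Lemma bigcap_countType_Gdelta (X : topologicalType) (K : countType)
    (W : K -> set X) : (forall k, open (W k)) -> Gdelta (\bigcap_k W k).
Proof.
move=> oW; exists (fun n => if unpickle n is Some k then W k else setT).
  by move=> n; case: unpickle => [k|]; [exact: oW|exact: openT].
apply/seteqP; split=> x Wx n _; first by case: unpickle => // k; exact: Wx.
by have := Wx (pickle n) I; rewrite pickleK.
Qed.

Lemma bigcap_countType_dense (X : topologicalType) (K : countType)
    (W : K -> set X) : compact [set: X] -> regular_space X ->
  (forall k, open (W k) /\ dense (W k)) -> dense (\bigcap_k W k).
Proof.
move=> cX rX oW.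
have oW' n : let V := if unpickle n is Some k then W k else setT in
    open V /\ dense V.
  case: unpickle => [k|]; first exact: oW.
  by split; [exact: openT|move=> O O0 _; rewrite setIT].
move=> O O0 /(compact_regular_Baire cX rX oW' O0)[x [Ox Wx]].
by exists x; split=> // k _; have := Wx (pickle k) I; rewrite pickleK.
Qed.

(** * The category argument in a compact regular space with dense orbits *)

Lemma minimal_dense_Gdelta_sub_ideal (X : ptopologicalType)
    (J : set (set X)) :
  compact [set: X] -> regular_space X ->
  (forall (x : X) (U : set X), open U -> U !=set0 ->
    exists2 h : X -> X, homeomorphism h & U (h x)) ->
  is_ideal J -> topologically_invariant J -> has_BP_base J ->
  ~ (J `<=` meager X) -> minimal_dense_Gdelta X `<=` J.
Proof.
move=> cX rX minX [[J0 JJ0] JS JU] Jinv JBP.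
move=> /existsNP[A /not_implyP[JA nmA]].
(* With [U] empty, the symmetric difference would be [B] itself, so [A] would be meager. *)
have [B [AB [U oU [F F0 BU]] JB]] := JBP A JA.
have U0 : U !=set0.
  apply/set0P/eqP => U0; apply: nmA; apply: meagerS AB _.
  by exists F => //; rewrite -BU U0 setY0.
have /choice[h hU] : forall x, exists h : X -> X, homeomorphism h /\ U (h x).
  by move=> x; have [k] := minX x U oU U0; exists k.
have /choice[g gP] : forall x, exists g : X -> X,
    homeomorphism g /\ cancel (h x) g /\ cancel g (h x).
  by move=> x; have [k] := homeomorphism_inv (hU x).1; exists k.
have hc x : continuous (h x) by have [[k []]] := hU x.
have : @cover_compact X setT by rewrite -compact_cover.
move=> /(_ X setT (fun x => h x @^-1` U))[||s _ scov].
- by move=> x _; apply: open_comp oU => y _; exact: hc.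
- by move=> x _; exists x => //; exact: (hU x).2.
pose D := \bigcup_(x in [set` s]) g x @` B.
have JD : J D.
  rewrite /D bigcup_fset; elim/big_ind: _ => //.
    by apply: JS JJ0; exact: sub0set.
  by move=> x _; apply: invariant_image (gP x).1 JB.
(* The first index is a position in the finite subcover [s]. Positions past its end fall back on
   [point], where [W k] is still open and dense. *)
pose W (k : nat * nat) := h (nth point s k.1) @^-1` (~` closure (F k.2)).
have oW k : open (W k) /\ dense (W k).
  exact: open_dense_preimage_nowhere_dense (hU _).1 (F0 _).
have WD : \bigcap_k W k `<=` D.
  move=> z Wz; have [x xs Uhz] := scov z I.
  exists x => //; exists (h x z); last exact: (gP x).2.1.
  (* A point of [U] outside [B] lies in some [F n], which membership of [z] in [W (index x s, n)]
     excludes. *)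
  apply: contrapT => nB.
  have : (B `+` U) (h x z) by right.
  rewrite BU => -[n _ Fn]; apply: (Wz (index x s, n) I) => /=.
  by rewrite nth_index//; exact: subset_closure.
move=> M [_ _ /(_ (\bigcap_k W k))[||k hk kM]].
- by apply: bigcap_countType_Gdelta => k; exact: (oW k).1.
- exact: bigcap_countType_dense.
have [k' hk' [kK _]] := homeomorphism_inv hk.
have -> : M = k' @` (k @` M).
  rewrite image_comp (_ : k' \o k = id) ?image_id//.
  by apply: funext => x; exact: kK.
by apply: invariant_image => //; exact: JS (subset_trans kM WD) JD.
Qed.

Local Open Scope ring_scope.

(** * Truncation to an interval *)

Definition clip (R : realDomainType) (a b x : R) : R := Num.max a (Num.min b x).

Lemma clip_itv (R : realDomainType) (a b x : R) :
  a <= b -> a <= clip a b x <= b.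
Proof. by rewrite /clip => ab; rewrite le_max lexx ge_max ab ge_min lexx. Qed.

Lemma clip_id (R : realDomainType) (a b x : R) :
  a <= x <= b -> clip a b x = x.
Proof.
by move=> /andP[ax xb]; rewrite /clip (min_idPr xb) (max_idPr ax).
Qed.

Lemma clip_ge (R : realDomainType) (a b x : R) : a <= b <= x -> clip a b x = b.
Proof. by move=> /andP[ab bx]; rewrite /clip (min_idPl bx) (max_idPr ab). Qed.

Lemma clip_le (R : realDomainType) (a b x : R) : x <= a <= b -> clip a b x = a.
Proof.
by move=> /andP[xa ab]; rewrite /clip (min_idPr (le_trans xa ab)) (max_idPl xa).
Qed.

(** The bounds vary with [t] because [twist] truncates at a radius that depends on the point. *)
Lemma clip_cvg (R : realType) (T : Type) (F : set_system T) (a b x : T -> R)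
    (la lb lx : R) : Filter F -> a @ F --> la -> b @ F --> lb -> x @ F --> lx ->
  (fun t => clip (a t) (b t) (x t)) @ F --> clip la lb lx.
Proof.
move=> FF ca cb cx; apply: (@continuous2_cvg _ R R R _ _ _ _ Num.max) => //.
  exact: max_continuous (la, Num.min lb lx).
apply: (@continuous2_cvg _ R R R _ _ _ _ Num.min) => //.
exact: min_continuous (lb, lx).
Qed.

(** * Coordinates, convergence and compactness in the Hilbert cube *)

Section Cube.
Context {R : realType}.
Implicit Types (x y : hilbert_cube R) (i j m n : nat).

Lemma clip_unit (r : R) : clip 0 1 r \in unit_interval R.
Proof. by rewrite inE /unit_interval /= in_itv/=; exact: clip_itv. Qed.

(** Truncation lets every real sequence define a point of the cube, without a proof of range inside
    the definition. *)
Definition to_unit (r : R) : set_type (unit_interval R) :=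
  exist _ (clip 0 1 r) (clip_unit r).

Definition coordinate x i : R := set_val (x i).

Definition of_coordinate (z : nat -> R) : hilbert_cube R :=
  fun i => to_unit (z i).

Lemma coordinate_itv x i : 0 <= coordinate x i <= 1.
Proof. by have := set_valP (x i); rewrite /unit_interval /= in_itv. Qed.

Lemma coordinate_inj x y : coordinate x =1 coordinate y -> x = y.
Proof.
by move=> xy; apply: functional_extensionality_dep => i; exact/val_inj/xy.
Qed.

Lemma of_coordinateK (z : nat -> R) i : 0 <= z i <= 1 ->
  coordinate (of_coordinate z) i = z i.
Proof. exact: clip_id. Qed.

Lemma cvg_unit (F : set_system (set_type (unit_interval R)))
    (u : set_type (unit_interval R)) : Filter F ->
  set_val @ F --> set_val u -> F --> u.
Proof.
move=> FF Fu A [_ [[B oB <-] Bu] BA]; apply: filterS BA _.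
by apply: Fu; exact: open_nbhs_nbhs.
Qed.

Lemma cvg_cube (F : set_system (hilbert_cube R)) x : Filter F ->
  (forall i, (coordinate^~ i) @ F --> coordinate x i) -> F --> x.
Proof.
(* The pattern unfolds two initial topologies: that of projection [i], then that of the inclusion of
   the interval in [R]. *)
move=> FF Fx; apply/cvg_sup => i U [_ [[B [C oC <-] <-] Bx] BU].
apply: filterS BU _; apply: (Fx i); exact: open_nbhs_nbhs.
Qed.

Lemma coordinate_continuous i : continuous (coordinate^~ i).
Proof.
move=> x; apply: (@continuous_comp _ _ _ (fun x : hilbert_cube R => x i)).
  exact: (@proj_continuous nat (fun=> set_type (unit_interval R)) i x).
exact: initial_continuous.
Qed.

Lemma to_unit_continuous : continuous to_unit.
Proof.
move=> r; apply: cvg_unit.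
apply: (@clip_cvg R R (nbhs r) (fun=> 0) (fun=> 1) id); last exact: cvg_id.
  exact: cvg_cst.
exact: cvg_cst.
Qed.

Lemma cube_compact : compact [set: hilbert_cube R].
Proof.
have cI : compact [set: set_type (unit_interval R)].
  rewrite (_ : setT = to_unit @` `[0, 1]).
    apply: continuous_compact; last exact: segment_compact.
    exact/continuous_subspaceT/to_unit_continuous.
  apply/seteqP; split=> // u _; exists (set_val u).
    by have := set_valP u.
  by apply/val_inj/clip_id; have := set_valP u; rewrite /unit_interval/= in_itv.
have := @tychonoff nat (fun=> set_type (unit_interval R)) (fun=> setT) (fun=> cI).
by rewrite (_ : [set _ | _] = setT)//; apply/seteqP; split.
Qed.

End Cube.

(** * Homeomorphisms of the cube acting on two coordinates *)

Section SquareHomeomorphisms.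
Context {R : realType}.
Implicit Types (F G : R * R -> R * R) (x y : hilbert_cube R) (i j m n : nat).

Definition unit_square (p : R * R) : Prop := 0 <= p.1 <= 1 /\ 0 <= p.2 <= 1.

(** Half of a homeomorphism of the square: assumed for [F G] and for [G F], it makes the
    restrictions mutually inverse homeomorphisms. Continuity is that of the map on the plane, at
    points of the square, which avoids subspace topologies. *)
Definition square_retraction F G : Prop :=
  forall p, unit_square p ->
    [/\ unit_square (F p), G (F p) = p & {for p, continuous F}].

Definition act_pair F i m x : hilbert_cube R :=
  let p := F (coordinate x i, coordinate x m) in
  of_coordinate (fun j =>
    if j == i then p.1 else if j == m then p.2 else coordinate x j).

Lemma coordinate_square x i m : unit_square (coordinate x i, coordinate x m).
Proof. by split; exact: coordinate_itv. Qed.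

Lemma coordinate_act_pair F G i m x : square_retraction F G ->
  forall j, coordinate (act_pair F i m x) j =
    let p := F (coordinate x i, coordinate x m) in
    if j == i then p.1 else if j == m then p.2 else coordinate x j.
Proof.
move=> FG j; apply: of_coordinateK.
have [[Fi Fm] _ _] := FG _ (coordinate_square x i m).
by case: ifP => // _; case: ifP => // _; exact: coordinate_itv.
Qed.

Lemma act_pairK F G i m : i != m ->
  square_retraction F G -> square_retraction G F ->
  cancel (act_pair F i m) (act_pair G i m).
Proof.
move=> im FG GF x; apply: coordinate_inj => j.
rewrite (coordinate_act_pair _ _ _ GF) !(coordinate_act_pair _ _ _ FG) /= !eqxx.
rewrite [m == i]eq_sym (negbTE im) -surjective_pairing.
have [_ -> _] := FG _ (coordinate_square x i m) => /=.
by case: eqVneq => [->//|_]; case: eqVneq => [->|].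
Qed.

Lemma act_pair_continuous F G i m :
  square_retraction F G -> continuous (act_pair F i m).
Proof.
move=> FG x.
have FF : Filter (act_pair F i m @ x) by exact: (fmap_filter _ (nbhs_filter x)).
apply: cvg_cube => j.
have cF : (fun z : hilbert_cube R => F (coordinate z i, coordinate z m)) @ x -->
    F (coordinate x i, coordinate x m).
  have [_ _ Fc] := FG _ (coordinate_square x i m).
  apply: cvg_comp; last exact: Fc.
  exact: (@cvg_pair _ _ _ (nbhs x) (nbhs (coordinate x i))
    (nbhs (coordinate x m)) _ _ _ _ _
    (@coordinate_continuous R i x) (@coordinate_continuous R m x)).
suff : (fun z => coordinate (act_pair F i m z) j) @ x -->
    coordinate (act_pair F i m x) j by [].
rewrite (coordinate_act_pair _ _ _ FG) /=.
under eq_fun do rewrite (coordinate_act_pair _ _ _ FG) /=.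
case: ifP => _; first by apply: (cvg_comp _ _ cF); exact: cvg_fst.
case: ifP => _; first by apply: (cvg_comp _ _ cF); exact: cvg_snd.
exact: coordinate_continuous.
Qed.

(** Here [i] is the coordinate to be adjusted and [m] a spare one that may be spoiled. Agreement
    elsewhere is asked only at the point [x], which is enough to follow one orbit. *)
Definition reach i m x y : Prop :=
  (exists2 h, homeomorphism h & h x = y) /\
  forall j, j != i -> j != m -> coordinate y j = coordinate x j.

Lemma reachC i m x y : reach i m x y -> reach m i x y.
Proof. by move=> [h xy]; split=> // j ji jm; exact: xy. Qed.

Lemma reach_trans i m x y z : reach i m x y -> reach i m y z -> reach i m x z.
Proof.
move=> [[h hh <-] xy] [[k hk <-] yz]; split.
  by exists (k \o h) => //; exact: homeomorphism_comp.
by move=> j ji jm; rewrite yz// xy.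
Qed.

Lemma reach_act F G i m x : i != m ->
  square_retraction F G -> square_retraction G F ->
  exists y, [/\ reach i m x y,
    coordinate y i = (F (coordinate x i, coordinate x m)).1 &
    coordinate y m = (F (coordinate x i, coordinate x m)).2].
Proof.
move=> im FG GF; exists (act_pair F i m x); split.
- split.
    exists (act_pair F i m) => //; exists (act_pair G i m).
    by split; [exact: act_pairK|exact: act_pairK|
      exact: act_pair_continuous FG|exact: act_pair_continuous GF].
  move=> j ji jm; rewrite (coordinate_act_pair _ _ _ FG) /=.
  by rewrite (negbTE ji) (negbTE jm).
- by rewrite (coordinate_act_pair _ _ _ FG) /= eqxx.
- by rewrite (coordinate_act_pair _ _ _ FG) /= [m == i]eq_sym (negbTE im) eqxx.
Qed.

Lemma pair_cvg (T : topologicalType) (f g : T -> R) (t : T) :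
  {for t, continuous f} -> {for t, continuous g} ->
  {for t, continuous (fun s => (f s, g s))}.
Proof.
move=> cf cg.
exact: (@cvg_pair _ _ _ (nbhs t) (nbhs (f t)) (nbhs (g t)) _ _ _ _ _ cf cg).
Qed.

Definition on_fst (f : R -> R) (p : R * R) : R * R := (f p.1, p.2).

Lemma on_fst_retraction (f g : R -> R) :
  (forall u, 0 <= u <= 1 ->
    [/\ 0 <= f u <= 1, g (f u) = u & {for u, continuous f}]) ->
  square_retraction (on_fst f) (on_fst g).
Proof.
move=> fg [u v] [/= uI vI]; have [fI gf cf] := fg u uI; split=> //.
  by rewrite /on_fst /= gf.
apply: pair_cvg; last exact: cvg_snd.
apply: (@cvg_comp _ _ _ fst f _ (nbhs u) _ _ cf); exact: cvg_fst.
Qed.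

Lemma flip_retraction :
  square_retraction (on_fst (fun u => 1 - u)) (on_fst (fun u => 1 - u)).
Proof.
apply: on_fst_retraction => u uI; split; [lra|lra|].
by apply: cvgB; [exact: cvg_cst|exact: cvg_id].
Qed.

(** The projective map fixing 0 and 1 that divides the odds u / (1 - u) by [c]; hence [mobius c^-1]
    is its inverse. *)
Definition mobius (c u : R) : R := u / (u + c * (1 - u)).

Lemma mobius_den (c u : R) : 0 < c -> 0 <= u <= 1 -> 0 < u + c * (1 - u).
Proof.
move=> c0 /andP[u0 u1].
have [->|un] := eqVneq u 0; first by rewrite add0r subr0 mulr1.
have u_gt0 : 0 < u by rewrite lt_neqAle eq_sym un.
by apply: ltr_pwDl => //; apply: mulr_ge0; lra.
Qed.

Lemma mobius_retraction (c : R) : 0 < c ->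
  square_retraction (on_fst (mobius c)) (on_fst (mobius c^-1)).
Proof.
move=> c0; apply: on_fst_retraction => u uI; have d0 := mobius_den c0 uI.
have dN0 := lt0r_neq0 d0; have cN0 := lt0r_neq0 c0.
split.
- have ? : 0 <= c * (1 - u) by apply: mulr_ge0; lra.
  by rewrite /mobius divr_ge0 ?(ltW d0) ?ler_pdivrMr//=; lra.
- rewrite /mobius; set d := u + _ in d0 dN0 *.
  have -> : u / d + c^-1 * (1 - u / d) = d^-1.
    by rewrite /d; field; rewrite dN0 cN0.
  by rewrite invrK mulfVK.
- apply: cvgM; first exact: cvg_id.
  apply: cvgV => //; apply: cvgD; first exact: cvg_id.
  apply: cvgM; first exact: cvg_cst.
  by apply: cvgB; [exact: cvg_cst|exact: cvg_id].
Qed.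

(* In coordinates centred at the middle of the square this is
   (u, v) |-> (clip_r (u + v), clip_r (u - v)) with r = max(|u|, |v|): it
   preserves each concentric square of radius r and permutes its boundary
   points by a reflection exchanging corners and edge midpoints. *)
Definition twist (p : R * R) : R * R :=
  let u := p.1 - 2^-1 in let v := p.2 - 2^-1 in
  let r := Num.max `|u| `|v| in
  (2^-1 + clip (- r) r (u + v), 2^-1 + clip (- r) r (u - v)).

(** On the boundary of the square of radius [r], split into eight half-sides, one of u + v and u - v
    reaches or passes a bound and is truncated to it, while the other stays in range. The image is
    thus again at radius [r], and the same computation returns (u, v). *)
Lemma clip_twistK (u v : R) : let r := Num.max `|u| `|v| in
  let u' := clip (- r) r (u + v) in let v' := clip (- r) r (u - v) in
  [/\ Num.max `|u'| `|v'| = r, clip (- r) r (u' + v') = u &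
      clip (- r) r (u' - v') = v].
Proof.
have max_norm (a b c : R) : - c <= a <= c -> - c <= b <= c ->
    [\/ a = c, a = - c, b = c | b = - c] -> Num.max `|a| `|b| = c.
  move=> ac bc; have [|] := lerP `|a| `|b|;
  by have [?|?] := ger0P a; have [?|?] := ger0P b => ?; case=> ?; lra.
move=> r u' v'.
have [ur vr uvr] : [/\ - r <= u <= r, - r <= v <= r &
    [\/ u = r, u = - r, v = r | v = - r]].
  by rewrite /r; case: (lerP `|u| `|v|);
  have [?|?] := ger0P u; have [?|?] := ger0P v => ?;
  (split; [lra|lra|]); rewrite ?opprK;
  [constructor 3|constructor 4|constructor 3|constructor 4
  |constructor 1|constructor 1|constructor 2|constructor 2].
(* Forgetting that [r] is a maximum leaves linear conditions on [u], [v] and [r]. *)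
rewrite {}/u' {}/v'; move: r ur vr uvr => r ur vr uvr.
have r0 : 0 <= r by lra.
case: uvr => uvr; 
  [have [w0|/ltW w0] := lerP 0 v|have [w0|/ltW w0] := lerP 0 v
  |have [w0|/ltW w0] := lerP 0 u|have [w0|/ltW w0] := lerP 0 u].
- rewrite (@clip_ge _ _ _ (u + v)); last lra.
  rewrite (@clip_id _ _ _ (u - v)); last lra.
  by split; [apply: max_norm; [lra|lra|constructor 1; lra]
    |rewrite clip_ge; lra|rewrite clip_id; lra].
- rewrite (@clip_id _ _ _ (u + v)); last lra.
  rewrite (@clip_ge _ _ _ (u - v)); last lra.
  by split; [apply: max_norm; [lra|lra|constructor 3; lra]
    |rewrite clip_ge; lra|rewrite clip_id; lra].
- rewrite (@clip_id _ _ _ (u + v)); last lra.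
  rewrite (@clip_le _ _ _ (u - v)); last lra.
  by split; [apply: max_norm; [lra|lra|constructor 4; lra]
    |rewrite clip_le; lra|rewrite clip_id; lra].
- rewrite (@clip_le _ _ _ (u + v)); last lra.
  rewrite (@clip_id _ _ _ (u - v)); last lra.
  by split; [apply: max_norm; [lra|lra|constructor 2; lra]
    |rewrite clip_le; lra|rewrite clip_id; lra].
- rewrite (@clip_ge _ _ _ (u + v)); last lra.
  rewrite (@clip_id _ _ _ (u - v)); last lra.
  by split; [apply: max_norm; [lra|lra|constructor 1; lra]
    |rewrite clip_id; lra|rewrite clip_ge; lra].
- rewrite (@clip_id _ _ _ (u + v)); last lra.
  rewrite (@clip_le _ _ _ (u - v)); last lra.
  by split; [apply: max_norm; [lra|lra|constructor 4; lra]
    |rewrite clip_id; lra|rewrite clip_ge; lra].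
- rewrite (@clip_id _ _ _ (u + v)); last lra.
  rewrite (@clip_ge _ _ _ (u - v)); last lra.
  by split; [apply: max_norm; [lra|lra|constructor 3; lra]
    |rewrite clip_id; lra|rewrite clip_le; lra].
- rewrite (@clip_le _ _ _ (u + v)); last lra.
  rewrite (@clip_id _ _ _ (u - v)); last lra.
  by split; [apply: max_norm; [lra|lra|constructor 2; lra]
    |rewrite clip_id; lra|rewrite clip_le; lra].
Qed.

Lemma twist_retraction : square_retraction twist twist.
Proof.
move=> [x y] [/= xI yI]; rewrite /twist /=.
pose u := x - 2^-1; pose v := y - 2^-1.
(* The square has half-width 1/2, so truncation at this radius keeps the image inside it. *)
have r2 : Num.max `|u| `|v| <= 2^-1.
  by rewrite ge_max !ler_norml /u /v; apply/andP; split; lra.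
have r0 : - Num.max `|u| `|v| <= Num.max `|u| `|v|.
  have : 0 <= Num.max `|u| `|v| by rewrite le_max normr_ge0.
  by lra.
split.
- have := clip_itv (u + v) r0; have := clip_itv (u - v) r0.
  by rewrite /u /v => ? ?; split=> /=; lra.
- rewrite !(addrC 2^-1) !addrK; have [-> -> ->] := clip_twistK u v.
  by rewrite !subrK.
- have cu : {for (x, y), continuous (fun p : R * R => p.1 - 2^-1)}.
    by apply: cvgB; [exact: cvg_fst|exact: cvg_cst].
  have cv : {for (x, y), continuous (fun p : R * R => p.2 - 2^-1)}.
    by apply: cvgB; [exact: cvg_snd|exact: cvg_cst].
  have cr : {for (x, y), continuous (fun p : R * R =>
      Num.max `|p.1 - 2^-1| `|p.2 - 2^-1|)}.
    apply: (@continuous2_cvg _ R R R _ _ _ _ Num.max); [|exact: cvg_norm..].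
    exact: max_continuous (`|x - 2^-1|, `|y - 2^-1|).
  apply: pair_cvg; (apply: cvgD; first exact: cvg_cst); apply: clip_cvg => //.
  + exact: cvgN.
  + exact: cvgD.
  + exact: cvgN.
  + exact: cvgB.
Qed.

End SquareHomeomorphisms.

(** * Density of the orbits *)

Section CubeOrbits.
Context {R : realType}.
Implicit Types (x y : hilbert_cube R) (i j m n : nat).

Lemma reach_refl i m x : reach i m x x.
Proof. by split=> //; exists id => //; exact: homeomorphism_id. Qed.

Lemma reach_interior i m x (t : R) : i != m -> 0 < coordinate x i < 1 ->
  0 < t < 1 ->
  exists y, [/\ reach i m x y, coordinate y i = t &
    coordinate y m = coordinate x m].
Proof.
move=> im; set s := coordinate x i => /andP[s0 s1] /andP[t0 t1].
have s1' : 0 < 1 - s by lra.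
have t1' : 0 < 1 - t by lra.
(* The ratio of the odds of [s] to those of [t], so that [mobius c] sends [s] to [t]. *)
pose c := (s * (1 - t)) / (t * (1 - s)).
have c0 : 0 < c by rewrite divr_gt0 ?mulr_gt0.
have ci0 : 0 < c^-1 by rewrite invr_gt0.
have mf := @mobius_retraction R c c0.
have mg := mobius_retraction ci0; rewrite invrK in mg.
have [y [xy yi ym]] := reach_act x im mf mg.
exists y; split=> //; rewrite yi /= -/s /mobius /c.
by field; rewrite !lt0r_neq0//; nra.
Qed.

Lemma reach_flip i m x : i != m ->
  exists y, [/\ reach i m x y, coordinate y i = 1 - coordinate x i &
    coordinate y m = coordinate x m].
Proof. by move=> im; exact: reach_act x im flip_retraction flip_retraction. Qed.

(** Prepares for [twist], which moves a point of the side where coordinate [i] is 0 off that side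
    only if coordinate [m] exceeds 1/2. *)
Lemma reach_upper i m x : i != m ->
  exists y, [/\ reach i m x y, coordinate y i = coordinate x i &
    2^-1 < coordinate y m].
Proof.
move=> im; have mi : m != i by rewrite eq_sym.
have /andP[x0 x1] := coordinate_itv x m.
have [xm0|xm0] := eqVneq (coordinate x m) 0.
  have [y [xy ym yi]] := reach_flip x mi.
  by exists y; split; [exact: reachC|done|rewrite ym xm0; lra].
have [xm1|xm1] := eqVneq (coordinate x m) 1.
  by exists x; split; [exact: reach_refl|done|rewrite xm1; lra].
have xmI : 0 < coordinate x m < 1.
  by rewrite !lt_neqAle x0 x1 eq_sym xm0 xm1.
have hI : 0 < (3 / 4 : R) < 1 by lra.
have [y [xy ym yi]] := reach_interior mi xmI hI.
by exists y; split; [exact: reachC|done|rewrite ym; lra].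
Qed.

Lemma reach_inside i m x : i != m ->
  exists y, reach i m x y /\ 0 < coordinate y i < 1.
Proof.
move=> im.
have reach_from0 z : coordinate z i = 0 ->
    exists y, reach i m z y /\ 0 < coordinate y i < 1.
  move=> z0; have [w [zw wi wm]] := reach_upper z im.
  (* The radius is 1/2 here, and [twist] gives coordinate [i] the value [coordinate w m - 2^-1], in
     (0, 1/2]. *)
  have [y [wy yi _]] := reach_act w im twist_retraction twist_retraction.
  exists y; split; first exact: reach_trans zw wy.
  have /andP[_ w1] := coordinate_itv w m.
  rewrite yi /twist /= wi z0 sub0r normrN.
  rewrite (ger0_norm (_ : 0 <= 2^-1)) ?invr_ge0// (max_idPl _); last first.
    by rewrite ler_norml; lra.
  by rewrite clip_id; lra.
have /andP[x0 x1] := coordinate_itv x i.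
have [xi0|xi0] := eqVneq (coordinate x i) 0; first exact: reach_from0.
have [xi1|xi1] := eqVneq (coordinate x i) 1.
  have [z [xz zi _]] := reach_flip x im.
  have [|y [zy yI]] := reach_from0 z; first by rewrite zi xi1 subrr.
  by exists y; split=> //; exact: reach_trans xz zy.
exists x; split; first exact: reach_refl.
by rewrite !lt_neqAle x0 x1 eq_sym xi0 xi1.
Qed.

Lemma reach_target i m x (t : R) : i != m -> 0 < t < 1 ->
  exists2 y, reach i m x y & coordinate y i = t.
Proof.
move=> im tI; have [y [xy yI]] := reach_inside x im.
have [z [yz zt _]] := reach_interior im yI tI.
by exists z => //; exact: reach_trans xy yz.
Qed.

Lemma orbit_cylinder x (t : nat -> R) n : (forall i, 0 < t i < 1) ->
  exists2 h : hilbert_cube R -> hilbert_cube R, homeomorphism h &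
    forall i, (i < n)%N -> coordinate (h x) i = t i.
Proof.
move=> tI; elim: n => [|n [h hh hxt]].
  by exists id => //; exact: homeomorphism_id.
(* The spare coordinate is [n.+1]: spoiling it is harmless, since only coordinates up to [n] are
   prescribed so far. *)
have nn : n != n.+1 by rewrite neq_ltn ltnSn.
have [_ [[k hk <-] hkx] kn] := reach_target (h x) nn (tI n).
exists (k \o h) => [|i]; first exact: homeomorphism_comp.
rewrite ltnS leq_eqVlt => /predU1P[->//|lin].
rewrite /= hkx ?hxt// neq_ltn; first by rewrite lin.
by rewrite ltnS (ltnW lin).
Qed.

(** Provides a target in [U] whose coordinates [orbit_cylinder] is able to prescribe. *)
Lemma open_interior_point (U : set (hilbert_cube R)) : open U -> U !=set0 ->
  exists2 v, U v & forall i, 0 < coordinate v i < 1.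
Proof.
move=> oU [u Uu].
(* The convex combination of [u] and the centre of the cube, the latter with weight 1/(k+1). *)
pose w (k : nat) i : R := (1 - harmonic k) * coordinate u i + harmonic k / 2.
have wI k i : 0 < w k i < 1.
  have /andP[u0 u1] := coordinate_itv u i.
  have e0 : 0 < harmonic k :> R by exact: harmonic_gt0.
  have e1 : harmonic k <= 1 :> R by rewrite invf_le1// ler1n.
  by rewrite /w; apply/andP; split; nra.
have wcoord k i : coordinate (of_coordinate (w k)) i = w k i.
  by apply: of_coordinateK; have /andP[/ltW -> /ltW ->] := wI k i.
have cw : of_coordinate (w k) @[k --> \oo] --> u.
  apply: cvg_cube => i.
  suff : w k i @[k --> \oo] --> coordinate u i.
    by under eq_fun do rewrite -wcoord.
  have -> : coordinate u i = (1 - 0) * coordinate u i + 0 / 2 by lra.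
  apply: cvgD; apply: cvgM; [|exact: cvg_cst|exact: cvg_harmonic|exact: cvg_cst].
  by apply: cvgB; [exact: cvg_cst|exact: cvg_harmonic].
have : \forall k \near \oo, U (of_coordinate (w k)).
  exact: cw U (open_nbhs_nbhs (conj oU Uu)).
move=> /filter_ex[k Uk].
by exists (of_coordinate (w k)) => // i; rewrite wcoord.
Qed.

(** The images [h n x] agree with [v] on the first [n] coordinates, so each coordinate is eventually
    constant and the images converge to [v]; the maps [h n] themselves need not converge. *)
Lemma orbit_dense x (U : set (hilbert_cube R)) : open U -> U !=set0 ->
  exists2 h : hilbert_cube R -> hilbert_cube R, homeomorphism h & U (h x).
Proof.
move=> oU U0; have [v Uv vI] := open_interior_point oU U0.
have /choice[h hP] : forall n, exists h : hilbert_cube R -> hilbert_cube R,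
    homeomorphism h /\ forall i, (i < n)%N -> coordinate (h x) i = coordinate v i.
  by move=> n; have [h] := orbit_cylinder x n vI; exists h.
have ch : h n x @[n --> \oo] --> v.
  apply: cvg_cube => i; apply: cvg_near_cst.
  by exists i.+1 => // n /= lin; exact: (hP n).2.
have : \forall n \near \oo, U (h n x).
  exact: ch U (open_nbhs_nbhs (conj oU Uv)).
move=> /filter_ex[n Un].
by exists (h n) => //; exact: (hP n).1.
Qed.

End CubeOrbits.

(** * The two inclusions for the Hilbert cube *)

HB.instance Definition _ (R : realType) :=
  isPointed.Build (hilbert_cube R) (of_coordinate (fun=> 0)).

Theorem theorem1p3 (R : realType) :
  (forall I : set (set (hilbert_cube R)),
     is_ideal I -> topologically_invariant I -> has_BP_base I ->
     ~ (I `<=` meager (hilbert_cube R)) ->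
     minimal_dense_Gdelta (hilbert_cube R) `<=` I) /\
  (forall I : set (set (hilbert_cube R)),
     is_sigma_ideal I -> topologically_invariant I -> has_BP_base I ->
     ~ (I `<=` meager (hilbert_cube R)) ->
     sigma_ideal_gen (minimal_dense_Gdelta (hilbert_cube R)) `<=` I).
Proof.
have minimal_sub (J : set (set (hilbert_cube R))) : is_ideal J ->
    topologically_invariant J -> has_BP_base J ->
    ~ (J `<=` meager (hilbert_cube R)) ->
    minimal_dense_Gdelta (hilbert_cube R) `<=` J.
  apply: minimal_dense_Gdelta_sub_ideal.
  - exact: cube_compact.
  - exact: uniform_regular.
  - exact: orbit_dense.
split=> // J [idJ sJ] Jinv JBP nJ A [C [cC CG AC]].
have CJ := subset_trans CG (minimal_sub J idJ Jinv JBP nJ).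
have [[J0 JJ0] JS _] := idJ; apply: (JS _ _ AC).
(* A countable family is empty or the range of a sequence [f]; only the latter can be fed to
   [sJ]. *)
have /pfcard_geP[->|/surjfunPex[f fC]] := cC.
  by rewrite bigcup_set0; apply: JS JJ0; exact: sub0set.
by rewrite fC bigcup_image; apply: sJ => n; apply: CJ; rewrite fC; exists n.
Qed.
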